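(* Let $\mathcal{A}$ be a generic arrangement of hyperplanes in $\mathbb{R}^k$ and let $X\in\mathcal{L}(\mathcal{B}(n,k,\mathcal{A}))$ with canonical presentation $\{L_1,\dots,L_m\}$, $X=\bigcap_{i=1}^mD_{L_i}$, where $n=|\bigcup_{i=1}^mL_i|$. If $\operatorname{rank}(X)=2$, then $a_X\le\frac{n}{n-k-1}$. Moreover, if $\frac{n}{n-k-1}$ is an integer, then there exists a generic arrangement of $n$ hyperplanes in $\mathbb{R}^k$ whose discriminantal arrangement has a non-very generic intersection $X$ satisfying $a_X=\frac{n}{n-k-1}$.
   Context: A central arrangement $\mathcal{A}=\{H_1,\dots,H_N\}$ in $\mathbb{R}^k$ ($k<N$), with normals $\alpha_i$, is generic if any $m\le k$ of its hyperplanes intersect in codimension $m$. Identify $\mathbb{R}^N$ with the space of parallel translates via $t\mapsto(H_i+t_i\alpha_i)_i$. For $L\subset[N]$, $|L|=k+1$, $D_L=\{t\mid\bigcap_{i\in L}(H_i+t_i\alpha_i)\ne\emptyset\}$ is a hyperplane; $\mathcal{B}(N,k,\mathcal{A})=\{D_L\}$ is the discriminantal arrangement with intersection poset $\mathcal{L}(\mathcal{B}(N,k,\mathcal{A}))$. For $|S|\ge k+1$, $D_S=\bigcap_{L\subset S,|L|=k+1}D_L$. $D_S$ is a component of $X$ if $X\subset D_S$ and $X\not\subset D_{S\cup\{j\}}$ for all $j\notin S$; the canonical presentation of $X$ is the set of index sets of all its components. Athanasiadis rank $a_X=\sum_i(|L_i|-k)$; $\operatorname{rank}(X)$ is the codimension;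 $X$ is very generic if $\operatorname{rank}(X)=a_X$, non-very generic otherwise.
   Formalization: The ''Moreover'' part excludes n=k+1 (quotient undefined), n=k+2 (every intersection is very generic, a_X≤2<k+2) and n=2(k+1) (quotient 2, and a_X=2 forces rank 2, so X is very generic), where the claim fails; the X produced also has rank 2 and components covering [n]. *)

(* Defs.v *)
From mathcomp Require Import all_boot all_order all_algebra.
From mathcomp Require Import all_classical reals.

Set Implicit Arguments.
Unset Strict Implicit.
Unset Printing Implicit Defensive.

Import GRing.Theory Num.Theory.
Local Open Scope classical_set_scope.
Local Open Scope ring_scope.

Definition codim (F : fieldType) (vT : vectType F) (U : {vspace vT}) : nat :=
  (\dim {:vT} - \dim U)%N.

(* A central arrangement of [n] hyperplanes in R^k is given by the matrix [A]
   whose [i]-th row is the normal vector alpha_i; it is indexed, so that for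
   k = 1 several hyperplanes may coincide. *)
Section Discriminantal.
Variables (R : realType) (n k : nat) (A : 'M[R]_(n, k)).

Definition hyperplane (i : 'I_n) : {vspace 'rV[R]_k} :=
  lker (linfun (mulmxr (row i A)^T : 'rV[R]_k -> 'M[R]_1)).

Definition generic : Prop :=
  forall I : {set 'I_n}, (#|I| <= k)%N ->
    codim (\bigcap_(i in I) hyperplane i)%VS = #|I|.

Definition translate (t : 'rV[R]_n) (i : 'I_n) : set 'rV[R]_k :=
  [set x + t 0 i *: row i A | x in [set` hyperplane i]].

(* Meant for #|L| = k + 1; for other index sets see [Dset]. *)
Definition D (L : {set 'I_n}) : set 'rV[R]_n :=
  [set t | \bigcap_(i in [set` L]) translate t i !=set0].

Definition Dset (S : {set 'I_n}) : set 'rV[R]_n :=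
  \bigcap_(L in [set L : {set 'I_n} | L \subset S /\ #|L| = k.+1]) D L.

(* Every intersection of the hyperplanes D_L is a linear subspace, so the
   elements of L(B(n, k, A)) are singled out among the subspaces of R^n. The
   empty family gives the whole space. *)
Definition in_intersection_poset (X : {vspace 'rV[R]_n}) : Prop :=
  exists2 F : {set {set 'I_n}}, (forall L, L \in F -> #|L| = k.+1)
    & [set` X] = \bigcap_(L in [set` F]) D L.

Definition is_component (X : {vspace 'rV[R]_n}) (S : {set 'I_n}) : Prop :=
  [/\ (k < #|S|)%N, [set` X] `<=` Dset S
    & forall j, j \notin S -> ~ [set` X] `<=` Dset (j |: S)%SET].

Definition canonical_presentation (X : {vspace 'rV[R]_n}) :
    {set {set 'I_n}} :=
  [set S : {set 'I_n} | `[< is_component X S >]]%SET.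

Definition athanasiadis_rank (X : {vspace 'rV[R]_n}) : nat :=
  (\sum_(S in canonical_presentation X) (#|S| - k))%N.

Definition very_generic (X : {vspace 'rV[R]_n}) : Prop :=
  codim X = athanasiadis_rank X.

End Discriminantal.

(* Main.v *)
Require Import Defs.
From mathcomp Require Import all_boot all_order all_algebra.
From mathcomp Require Import all_classical reals.
From mathcomp Require Import lra zify.

(* Call a vector in the left kernel of A a word. By the Fredholm alternative,
   D_S is the orthogonal of the words supported in S (with the weights |alpha_i|^2), and A
   is generic iff every nonzero word has more than k nonzero coordinates. If X
   has codimension 2, the words orthogonal to X span at most a plane.

   Bound: unless n = k + 2, every component has k + 1 elements and supports a
   single word up to scaling. The i-th coordinate does not vanish identically on
   the plane, so it vanishes on at most one line of it: each i is missed by at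
   most one component, while each component misses n - k - 1 indices.

   Sharpness: put d = n - k - 1 and q = n / d. Take a real polynomial f of degree
   d and q values e_s each having d simple real preimages, and let the words be
   the values at these n points of the polynomials of degree at most d. The
   annihilator X of the pencil spanned by 1 and f has as components the q
   complements of the fibres of f, which are the supports of the f - e_s. *)

Set Implicit Arguments.
Unset Strict Implicit.
Unset Printing Implicit Defensive.

Import Order.TTheory GRing.Theory Num.Theory.
Local Open Scope ring_scope.

(** * Words and genericity *)

Lemma codim_lker (F : fieldType) (m n : nat) (M : 'M[F]_(m, n)) :
  row_free M ->
  codim (lker (linfun (mulmxr M^T : 'rV[F]_n -> 'rV[F]_m))) = m.
Proof.
move=> freeM; rewrite /codim.
set f := linfun _.
have imf : limg f = fullv.
  apply/vspaceP => z; rewrite memvf; apply/memv_imgP.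
  exists (z *m (pinvmx M)^T); first exact: memvf.
  by rewrite lfunE /= -mulmxA -trmx_mul mulmxVp // trmx1 mulmx1.
have := limg_ker_dim f fullv.
rewrite capfv imf => <-.
by rewrite addKn dimvf /dim /= mul1n.
Qed.

Lemma codim_le (F : fieldType) (vT : vectType F) (U V : {vspace vT}) :
  (U <= V)%VS -> (codim V <= codim U)%N.
Proof. by move=> /dimvS leUV; rewrite leq_sub2l. Qed.

Lemma subset_between (T : finType) (B S : {set T}) m :
  B \subset S -> (#|B| <= m <= #|S|)%N ->
  exists L : {set T}, [/\ B \subset L, L \subset S & #|L| = m].
Proof.
elim: m => [|m IHm] BS /andP[leB leS].
  by exists B; split=> //; apply/eqP; rewrite -leqn0.
move: leB; rewrite leq_eqVlt => /orP[/eqP <-|leB]; first by exists B.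
have [|L [BL LS cardL]] := IHm BS; first by rewrite -ltnS leB ltnW.
have /properP[_ [x xS xL]] : L \proper S by rewrite properEcard LS cardL.
exists (x |: L)%SET; split; last by rewrite cardsU1 xL cardL.
  by apply: fintype.subset_trans BL (finset.subsetUr _ _).
by rewrite finset.subUset LS finset.sub1set xS.
Qed.

Section Words.
Variables (R : realType) (n k : nat) (A : 'M[R]_(n, k)).
Implicit Types (c t s : 'rV[R]_n) (y : 'rV[R]_k) (S L I : {set 'I_n}) (i : 'I_n).

Definition sqnorm i : R := (row i A *m (row i A)^T) 0 0.

Definition supported S c := forall i, i \notin S -> c 0 i = 0.

Lemma mem_hyperplane i y : (y \in hyperplane A i) = ((y *m A^T) 0 i == 0).
Proof.
rewrite memv_ker lfunE /=.
have -> : (y *m A^T) 0 i = (y *m (row i A)^T) 0 0.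
  by rewrite !mxE; apply: eq_bigr => j _; rewrite !mxE.
apply/eqP/eqP => [-> | e]; first by rewrite mxE.
by apply/matrixP => a b; rewrite !ord1 e mxE.
Qed.

Lemma mem_bigcap_hyperplane S y :
  reflect (forall i, i \in S -> (y *m A^T) 0 i = 0)
          (y \in \bigcap_(i in S) hyperplane A i)%VS.
Proof.
rewrite memvE; apply: (iffP subv_bigcapP) => H i iS.
  by apply/eqP; rewrite -mem_hyperplane memvE; apply: H.
by rewrite -memvE mem_hyperplane H.
Qed.

(** Fredholm alternative for the equations indexed by [L], with the words supported in [L] as test
    vectors. *)
Lemma solvable_iff_orthogonal L s :
  (exists y, forall i, i \in L -> (y *m A^T) 0 i = s 0 i) <->
  (forall c, c *m A = 0 -> supported L c -> \sum_i c 0 i * s 0 i = 0).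
Proof.
split=> [[y Hy] c cA cL | H].
  have -> : \sum_i c 0 i * s 0 i = (c *m (y *m A^T)^T) 0 0.
    rewrite mxE; apply: eq_bigr => i _.
    case: (boolP (i \in L)) => iL; last by rewrite cL // !mul0r.
    by rewrite [in RHS]mxE Hy.
  by rewrite trmx_mul trmxK mulmxA cA mul0mx mxE.
(* Projecting onto the coordinates in [L] turns solvability into a row-space membership; the columns
   of the cokernel, projected by [P], are the words to test against. *)
pose P : 'M[R]_n := diag_mx (\row_i (i \in L)%:R).
have : (s *m P <= (P *m A)^T)%MS.
  rewrite submxE; apply/eqP/rowP => j; rewrite [RHS]mxE.
  set K := cokermx _.
  have cA : (col j K)^T *m P *m A = 0.
    rewrite -mulmxA tr_col -row_mul -[P *m A]trmxK -trmx_mul.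
    by rewrite mulmx_coker trmx0 row0.
  have PE (c : 'rV[R]_n) i : (c *m P) 0 i = c 0 i * (i \in L)%:R.
    by rewrite mul_mx_diag !mxE.
  have cL : supported L ((col j K)^T *m P).
    by move=> i /negbTE iL; rewrite PE iL mulr0.
  rewrite -[RHS](H _ cA cL) mxE; apply: eq_bigr => i _.
  by rewrite !PE [_^T 0 i]mxE [col j K _ _]mxE [RHS]mulrC [K i j * _]mulrC mulrA.
move=> /submxP[y e]; exists y => i iL.
have /rowP/(_ i) := e.
rewrite trmx_mul mulmxA /P tr_diag_mx !mul_mx_diag !mxE iL !mulr1 => ->.
by apply: eq_bigr => l _; rewrite !mxE.
Qed.

(** If [c 0 i] were nonzero, [alpha_i] would be a combination of the other normals in [I]. Dropping
    [i] would leave the intersection unchanged, although its codimension must fall by one. *)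
Lemma generic_word_eq0 : generic A ->
  forall I c, (#|I| <= k)%N -> c *m A = 0 -> supported I c -> c = 0.
Proof.
move=> genA I c leI cA cI; apply/rowP => i; rewrite mxE.
apply/eqP; apply: contraT => ci.
have iI : i \in I by apply: contraT => /cI /eqP; rewrite (negbTE ci).
have cardI := cardsD1 i I; rewrite iI in cardI.
have := genA I leI.
have <- : (\bigcap_(j in I :\ i) hyperplane A j = \bigcap_(j in I) hyperplane A j)%VS.
  apply/vspaceP => y; apply/mem_bigcap_hyperplane/mem_bigcap_hyperplane => H j.
    case: (eqVneq j i) => [-> _ | ji jI]; last by apply: H; rewrite !inE ji.
    have : (y *m (c *m A)^T) 0 0 = 0 by rewrite cA trmx0 mulmx0 mxE.
    rewrite trmx_mul mulmxA mxE (bigD1 i) //= big1 ?addr0 => [/eqP|l li].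
      by rewrite mulf_eq0 [_^T _ _]mxE (negbTE ci) orbF => /eqP.
    case: (boolP (l \in I)) => lI; last by rewrite [_^T _ _]mxE cI ?mulr0.
    by rewrite H ?mul0r // !inE li.
  by rewrite !inE => /andP[_]; apply: H.
rewrite genA; first by rewrite cardI => /eqP; rewrite add1n ltn_eqF.
by apply: leq_trans leI; rewrite cardI leq_addl.
Qed.

(** Extension by zero: a combination of the rows indexed by [I] becomes a combination of all
    rows. *)
Lemma extend_word I (z : 'rV[R]_#|I|) : exists c,
  [/\ supported I c, c *m A = z *m rowsub (enum_val : 'I_#|I| -> 'I_n) A
    & forall b, c 0 (enum_val b) = z 0 b].
Proof.
pose e : 'I_#|I| -> 'I_n := enum_val.
exists (z *m rowsub e 1%:M); split=> [i iI||b].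
- rewrite mxE big1 // => b _; rewrite !mxE.
  by case: eqP => [ebi|_]; [rewrite -ebi enum_valP in iI | rewrite mulr0].
- by rewrite -mulmxA mul_rowsub_mx mul1mx.
- rewrite mxE (bigD1 b) //= big1 ?addr0 => [|b' b'b]; rewrite !mxE.
    by rewrite eqxx mulr1.
  by rewrite (inj_eq enum_val_inj) (negbTE b'b) mulr0.
Qed.

(** A relation among the rows in [I] extends by zero to a word, so these rows are independent and
    the intersection is the kernel of a map of rank [#|I|]. *)
Lemma word_eq0_generic :
  (forall I c, (#|I| <= k)%N -> c *m A = 0 -> supported I c -> c = 0) ->
  generic A.
Proof.
move=> H I leI.
pose M := rowsub (enum_val : 'I_#|I| -> 'I_n) A.
have freeM : row_free M.
  rewrite -kermx_eq0; apply/eqP/row_matrixP => a; rewrite row0.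
  have [c [cI cA cE]] := extend_word (row a (kermx M)).
  apply/rowP => b; rewrite -cE (H I c leI) ?mxE //.
  by rewrite cA -row_mul mulmx_ker row0.
rewrite -[RHS](codim_lker freeM); congr codim; apply/vspaceP => y.
rewrite memv_ker lfunE /=.
have E b : (y *m M^T) 0 b = (y *m A^T) 0 (enum_val b).
  by rewrite !mxE; apply: eq_bigr => j _; rewrite !mxE.
apply/mem_bigcap_hyperplane/eqP => [Hy | Hy i iI].
  by apply/rowP => b; rewrite E Hy ?enum_valP // mxE.
by rewrite -(enum_rankK_in iI iI) -E Hy mxE.
Qed.

End Words.

(** * Equations of [D_L] and [D_S] for a generic arrangement *)

Section GenericWords.
Variables (R : realType) (n k : nat) (A : 'M[R]_(n, k)).
Hypotheses (genA : generic A) (k_gt0 : (0 < k)%N).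
Implicit Types (c t : 'rV[R]_n) (y : 'rV[R]_k) (S L I : {set 'I_n}) (i : 'I_n).

(** A zero normal would make the unit vector at [i] a word with a single nonzero coordinate, while
    [1 <= k]. *)
Lemma sqnorm_neq0 i : sqnorm A i != 0.
Proof.
apply/eqP => normi0.
have row0 : row i A = 0.
  apply/rowP => j; rewrite [RHS]mxE; apply/eqP; rewrite -sqrf_eq0; apply/eqP.
  have := normi0; rewrite /sqnorm mxE => /eqP; rewrite psumr_eq0 => [|l _].
    by move=> /allP/(_ j); rewrite mem_index_enum [_^T _ _]mxE -expr2 => /(_ isT)/eqP.
  by rewrite [_^T _ _]mxE -expr2 sqr_ge0.
have : delta_mx 0 i = 0 :> 'rV[R]_n.
  apply: (generic_word_eq0 genA (I := [set i])); first by rewrite cards1.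
    by rewrite -rowE.
  by move=> j; rewrite !inE mxE eqxx => /negbTE ->.
by move=> /rowP/(_ i); rewrite !mxE !eqxx => /eqP; rewrite oner_eq0.
Qed.

(** The [k + 1] rows in [L] satisfy a nontrivial relation; a zero coefficient would leave a support
    of at most [k] elements, which genericity forbids. *)
Lemma full_support_word L : #|L| = k.+1 ->
  exists2 c : 'rV[R]_n, c *m A = 0 & forall i, (c 0 i != 0) = (i \in L).
Proof.
move=> cardL.
pose M := rowsub (enum_val : 'I_#|L| -> 'I_n) A.
have : kermx M != 0.
  rewrite kermx_eq0 /row_free; apply: contraTneq (rank_leq_col M) => ->.
  by rewrite cardL ltnn.
move=> /rowV0Pn[z /sub_kermxP zA z0].
have [c [cL cA cE]] := extend_word A z.
exists c => [|i]; first by rewrite cA.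
apply/idP/idP => [ci|iL]; first by apply: contraT => /cL/eqP; rewrite (negbTE ci).
apply: contra z0 => /eqP ci; apply/eqP/rowP => b; rewrite mxE -cE.
rewrite (generic_word_eq0 genA (I := L :\ i) (c := c)) ?mxE //.
- by rewrite -ltnS -cardL [X in (_ < X)%N](cardsD1 i) iL.
- by rewrite cA.
- move=> j; rewrite !inE negb_and negbK; case: eqP => [-> //|_]; exact: cL.
Qed.

(* The hyperplane y . alpha_i = 0 translated by t_i alpha_i has equation
   y . alpha_i = |alpha_i|^2 t_i, hence the weights. *)
Definition pairing c t : R := \sum_i c 0 i * (sqnorm A i * t 0 i).

Lemma pairingB c c' t a : pairing (c - a *: c') t = pairing c t - a * pairing c' t.
Proof.
rewrite /pairing mulr_sumr -sumrB; apply: eq_bigr => i _.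
by rewrite !mxE mulrBl -[a * _ * _]mulrA.
Qed.

Lemma pairingZ a c t : pairing (a *: c) t = a * pairing c t.
Proof. by rewrite /pairing mulr_sumr; apply: eq_bigr => i _; rewrite mxE -mulrA. Qed.

(** A common point [y] of the translates solves the system with right-hand side [|alpha_i|^2 t_i],
    so the Fredholm alternative applies. *)
Lemma mem_D L t :
  D A L t <-> forall c, c *m A = 0 -> supported L c -> pairing c t = 0.
Proof.
pose s : 'rV[R]_n := \row_i (sqnorm A i * t 0 i).
have sE c : pairing c t = \sum_i c 0 i * s 0 i.
  by apply: eq_bigr => i _; rewrite [s _ _]mxE.
have key := solvable_iff_orthogonal A L s.
have rowA y i : (y *m A^T) 0 i = (y *m (row i A)^T) 0 0.
  by rewrite !mxE; apply: eq_bigr => j _; rewrite !mxE.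
have normE y i : ((y + t 0 i *: row i A) *m A^T) 0 i = (y *m A^T) 0 i + s 0 i.
  rewrite mulmxDl mxE; congr (_ + _); rewrite rowA -scalemxAl mxE.
  by rewrite [s 0 i]mxE mulrC.
split=> [[y Hy] | H].
  move=> c cA cL; rewrite sE; apply: (key.1 _) cA cL.
  exists y => i iL; have [x /= xH <-] := Hy i iL.
  rewrite normE; move: xH; rewrite mem_hyperplane => /eqP ->; exact: add0r.
have [|y Hy] := key.2 _; first by move=> c cA cL; rewrite -sE; apply: H.
exists y => i /= iL; exists (y - t 0 i *: row i A); last by rewrite subrK.
by rewrite /= mem_hyperplane -(inj_eq (addIr (s 0 i))) -normE subrK add0r Hy.
Qed.

(** The words supported on [(k + 1)]-subsets of [S] span all words supported in [S], by induction on
    the size of the support. *)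
Lemma mem_Dset S t : (k < #|S|)%N ->
  Dset A S t <-> forall c, c *m A = 0 -> supported S c -> pairing c t = 0.
Proof.
move=> ltS; split=> [H c | H L /= [LS cardL]]; last first.
  apply/mem_D => c cA cL; apply: H => // i iS; apply: cL.
  by apply: contra iS; apply: (fintype.subsetP LS).
have [m] := ubnP #|[set i | c 0 i != 0]|.
elim: m c => // m IHm c; rewrite ltnS => lem cA cS.
set supp := [set i | c 0 i != 0] in lem.
have suppS : supp \subset S.
  by apply/fintype.subsetP => i; rewrite inE; apply: contraR => /cS ->.
have supE i : (i \in supp) = (c 0 i != 0) by rewrite inE.
have [lek | ltk] := leqP #|supp| k.+1.
  have [|L [supL LS cardL]] := subset_between (m := k.+1) suppS; first by rewrite lek.
  move/mem_D: (H L (conj LS cardL)); apply=> // i iL.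
  by apply/eqP; apply: contraNT iL; rewrite -supE; apply: (fintype.subsetP supL).
have [|L [_ Lsup cardL]] := subset_between (m := k.+1) (finset.sub0set supp).
  by rewrite finset.cards0 /= ltnW.
have [c' c'A c'L] := full_support_word cardL.
have [i iL] : exists i, i \in L by apply/set0Pn; rewrite -card_gt0 cardL.
have c'i : c' 0 i != 0 by rewrite c'L.
have c'S j : j \notin supp -> c' 0 j = 0.
  by move=> js; apply/eqP; apply: contraNT js; rewrite c'L; apply: (fintype.subsetP Lsup).
(* The coordinate [i] is cancelled and no new one appears, so [c2] has strictly smaller support than
   [c]. *)
pose c2 := c - (c 0 i / c' 0 i) *: c'.
have -> : pairing c t = pairing c2 t.
  rewrite pairingB; suff -> : pairing c' t = 0 by rewrite mulr0 subr0.
  move/mem_D: (H L (conj (fintype.subset_trans Lsup suppS) cardL)); apply=> // j.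
  by rewrite -c'L negbK => /eqP.
apply: IHm.
- apply: leq_trans lem; apply: proper_card; apply/properP; split.
    apply/fintype.subsetP => j; apply: contraLR => js; rewrite inE negbK !mxE.
    by rewrite (c'S j js) mulr0 subr0 -[_ == _]negbK -supE.
  exists i; first by apply: (fintype.subsetP Lsup).
  by rewrite inE !mxE divfK // subrr eqxx.
- by rewrite mulmxBl -scalemxAl cA c'A scaler0 subr0.
- move=> j jS; rewrite !mxE (cS j jS) (c'S j) ?mulr0 ?subr0 //.
  by apply: contra jS; apply: (fintype.subsetP suppS).
Qed.

End GenericWords.

(** * Intersections of rank two *)

Section Annihilation.
Variables (R : realType) (n k : nat) (A : 'M[R]_(n, k)).
Hypotheses (genA : generic A) (k_gt0 : (0 < k)%N).
Implicit Types (c t : 'rV[R]_n) (S L I : {set 'I_n}) (i : 'I_n).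

(** The diagonal factor carries the weights of [pairing], so this is the annihilator of the row
    space of [W] for that form. *)
Definition orthogonal_space m (W : 'M[R]_(m, n)) : {vspace 'rV[R]_n} :=
  lker (linfun (mulmxr (W *m diag_mx (\row_i sqnorm A i))^T
                  : 'rV[R]_n -> 'rV[R]_m)).

Lemma mem_orthogonal_space m (W : 'M[R]_(m, n)) t :
  reflect (forall a, pairing A (row a W) t = 0) (t \in orthogonal_space W).
Proof.
have E a : (t *m (W *m diag_mx (\row_i sqnorm A i))^T) 0 a = pairing A (row a W) t.
  rewrite mxE; apply: eq_bigr => i _.
  by rewrite [_^T _ _]mxE mul_mx_diag !mxE mulrC -mulrA.
rewrite memv_ker lfunE /=; apply: (iffP eqP) => [H a | H].
  by rewrite -E H mxE.
by apply/rowP => a; rewrite E H mxE.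
Qed.

Lemma codim_orthogonal_space m (W : 'M[R]_(m, n)) :
  row_free W -> codim (orthogonal_space W) = m.
Proof.
move=> freeW; apply: codim_lker.
rewrite /row_free mxrankMfree // row_free_unit unitmxE det_diag unitfE.
by apply/prodf_neq0 => i _; rewrite mxE sqnorm_neq0.
Qed.

Variable X : {vspace 'rV[R]_n}.

Definition annihilates c := forall t, t \in X -> pairing A c t = 0.

Lemma sub_Dset S : (k < #|S|)%N ->
  ([set` X] `<=` Dset A S)%classic <->
  (forall c, c *m A = 0 -> supported S c -> annihilates c).
Proof.
move=> ltS; split=> [XS c cA cS t tX | H t tX].
  exact: ((mem_Dset genA t ltS).1 (XS t tX)).
by apply/(mem_Dset genA t ltS) => c cA cS; apply: H tX.
Qed.

Hypothesis codimX : codim X = 2%N.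

(** On the columns [i1], [i2], [i3] the three vectors form a triangular matrix with nonzero
    diagonal. They are independent, which would force codimension at least 3. *)
Lemma no_three_annihilators c1 c2 c3 i1 i2 i3 :
  annihilates c1 -> annihilates c2 -> annihilates c3 ->
  [/\ c1 0 i1 != 0, c1 0 i2 = 0 & c1 0 i3 = 0] ->
  [/\ c2 0 i2 != 0, c2 0 i1 = 0 & c2 0 i3 = 0] ->
  c3 0 i3 != 0 -> False.
Proof.
move=> X1 X2 X3 [c1i1 c1i2 c1i3] [c2i2 c2i1 c2i3] c3i3.
pose W : 'M[R]_(3, n) := \matrix_a nth 0 [:: c1; c2; c3] a.
have freeW : row_free W.
  rewrite -kermx_eq0; apply/eqP/row_matrixP => a; rewrite row0.
  set v := row a _.
  have vW : v *m W = 0 by rewrite /v -row_mul mulmx_ker row0.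
  have vE i : v 0 0 * c1 0 i + v 0 1 * c2 0 i + v 0 2 * c3 0 i = 0.
    have /rowP/(_ i) := vW; rewrite mxE [RHS]mxE => <-.
    rewrite !big_ord_recr big_ord0 /= add0r ![W _ _]mxE /=.
    by congr (v 0 _ * _ + v 0 _ * _ + v 0 _ * _); apply: val_inj.
  (* Column [i3] sees only [c3]; once its coefficient is zero, columns [i1] and [i2] isolate the
     other two. *)
  have := vE i3; rewrite c1i3 c2i3 !mulr0 !add0r => /eqP.
  rewrite mulf_eq0 (negbTE c3i3) orbF => /eqP v2.
  have := vE i1; rewrite v2 c2i1 mulr0 mul0r !addr0 => /eqP.
  rewrite mulf_eq0 (negbTE c1i1) orbF => /eqP v0.
  have := vE i2; rewrite v2 c1i2 mulr0 mul0r add0r addr0 => /eqP.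
  rewrite mulf_eq0 (negbTE c2i2) orbF => /eqP v1.
  apply/rowP => b; rewrite [RHS]mxE.
  case: b => [[|[|[|//]]] lt]; [rewrite -[RHS]v0|rewrite -[RHS]v1|rewrite -[RHS]v2];
    by congr (v 0 _); apply: val_inj.
suff /codim_le : (X <= orthogonal_space W)%VS by rewrite codim_orthogonal_space // codimX.
apply/subvP => t tX; apply/mem_orthogonal_space => a; rewrite rowK.
by case: a => [[|[|[|//]]] lt] /=; [apply: X1 | apply: X2 | apply: X3].
Qed.

Definition covers i := exists2 c, annihilates c & c 0 i != 0.

(** Take [B] of size [k] in [S] and two further points [j1], [j2] of [S]. An index outside these
    [k + 2] would be covered by a third annihilator, independent of the words on [B] with [j1] and
    on [B] with [j2]. *)
Lemma large_component S : (forall i, covers i) ->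
  ([set` X] `<=` Dset A S)%classic -> (k.+1 < #|S|)%N -> n = k.+2.
Proof.
move=> cov XS ltS.
have annS := (sub_Dset (ltnW ltS)).1 XS.
have [|B [_ BS cardB]] := subset_between (m := k) (finset.sub0set S).
  by rewrite finset.cards0 /= ltnW // ltnW.
have : (1 < #|S :\: B|)%N.
  by rewrite cardsDS // cardB ltn_subRL addn1.
move=> /card_gt1P[j1 [j2 []]]; rewrite !inE => /andP[j1B j1S] /andP[j2B j2S] j12.
have word j : j \in S -> j \notin B ->
    exists2 c, annihilates c & forall i, (c 0 i != 0) = (i \in j |: B)%SET.
  move=> jS jB; have cardL : #|j |: B|%SET = k.+1 by rewrite cardsU1 jB cardB.
  have [c cA cL] := full_support_word genA cardL.
  exists c => //; apply: annS => // i iS; apply/eqP; apply: contraNT iS.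
  by rewrite cL !inE => /orP[/eqP -> // | ]; apply: (fintype.subsetP BS).
have [c1 X1 c1E] := word j1 j1S j1B.
have [c2 X2 c2E] := word j2 j2S j2B.
have cardU : #|j1 |: (j2 |: B)|%SET = k.+2.
  by rewrite !cardsU1 !inE negb_or j12 j1B j2B cardB.
suff UT : (j1 |: (j2 |: B))%SET = finset.setT.
  by rewrite -cardU UT cardsT card_ord.
apply/finset.setP => i; rewrite [RHS]inE; apply: contraT.
rewrite !inE !negb_or => /and3P[ij1 ij2 iB].
have [c3 X3 c3i] := cov i.
have z c j l : (forall i, (c 0 i != 0) = (i \in j |: B)%SET) ->
    l != j -> l \notin B -> c 0 l = 0.
  by move=> cE lj lB; apply/eqP/negbFE; rewrite cE !inE (negbTE lj) (negbTE lB).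
case: (no_three_annihilators X1 X2 X3 (i1 := j1) (i2 := j2) (i3 := i)) => //; split.
- by rewrite c1E !inE eqxx.
- by apply: z c1E _ _; rewrite // eq_sym.
- exact: z c1E _ _.
- by rewrite c2E !inE eqxx.
- exact: z c2E _ _.
- exact: z c2E _ _.
Qed.

(** If the sets differed, the words on [S] and [S'] would be separated by points of the two
    differences and both would vanish at [i]; an annihilator covering [i] would be a third
    independent one. *)
Lemma small_component_unique S S' i : covers i ->
  ([set` X] `<=` Dset A S)%classic -> ([set` X] `<=` Dset A S')%classic ->
  #|S| = k.+1 -> #|S'| = k.+1 -> i \notin S -> i \notin S' -> S = S'.
Proof.
move=> [c3 X3 c3i] XS XS' cardS cardS' iS iS'.
apply/eqP; apply: contraT => neqS.
have word (T : {set 'I_n}) : ([set` X] `<=` Dset A T)%classic -> #|T| = k.+1 ->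
    exists2 c, annihilates c & forall i, (c 0 i != 0) = (i \in T).
  move=> XT cardT; have [c cA cT] := full_support_word genA cardT.
  exists c => //; apply: ((sub_Dset _).1 XT) => //; first by rewrite cardT.
  by move=> j; rewrite -cT negbK => /eqP.
have [c1 X1 c1E] := word S XS cardS.
have [c2 X2 c2E] := word S' XS' cardS'.
have diff (T T' : {set 'I_n}) : #|T| = #|T'| -> T != T' ->
    exists2 j, j \in T & j \notin T'.
  move=> cardT TT'; apply/fintype.subsetPn; apply: contra TT' => sT.
  by rewrite eqEcard sT cardT /=.
have [j1 j1S j1S'] := diff S S' (etrans cardS (esym cardS')) neqS.
have [|j2 j2S' j2S] := diff S' S (etrans cardS' (esym cardS)); first by rewrite eq_sym.
have z (c : 'rV[R]_n) l : (c 0 l != 0) = false -> c 0 l = 0 by move/negbFE/eqP.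
case: (no_three_annihilators X1 X2 X3 (i1 := j1) (i2 := j2) (i3 := i)) => //; split.
- by rewrite c1E.
- by apply: z; rewrite c1E (negbTE j2S).
- by apply: z; rewrite c1E (negbTE iS).
- by rewrite c2E.
- by apply: z; rewrite c2E (negbTE j1S').
- by apply: z; rewrite c2E (negbTE iS').
Qed.

(** A [(k + 1)]-subset of [S] through [i] supports a word that is nonzero at [i]. *)
Lemma component_covers S i : ([set` X] `<=` Dset A S)%classic ->
  (k < #|S|)%N -> i \in S -> covers i.
Proof.
move=> XS ltS iS.
have [||L [iL LS cardL]] := @subset_between _ [set i]%SET S k.+1.
- by rewrite finset.sub1set.
- by rewrite cards1.
have [c cA cL] := full_support_word genA cardL.
exists c; last by rewrite cL -finset.sub1set.
apply: ((sub_Dset ltS).1 XS) => // j jS; apply/eqP; apply: contraNT jS.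
by rewrite cL; apply: (fintype.subsetP LS).
Qed.

End Annihilation.

(** * The upper bound by double counting *)

Section Bound.
Variables (R : realType) (n k : nat) (A : 'M[R]_(n, k)).
Hypotheses (genA : generic A) (k_gt0 : (0 < k)%N) (lt_kn : (k < n)%N).
Variable X : {vspace 'rV[R]_n}.
Hypothesis codimX : codim X = 2%N.

(** For [n = k + 1] all words are multiples of a single one, so [X] has codimension at most 1. This
    keeps the denominator [n - k - 1] positive. *)
Lemma codim2_card_neq : in_intersection_poset A X -> n <> k.+1.
Proof.
move=> [F cardF XE] nE.
have [c cA cE] : exists2 c : 'rV[R]_n, c *m A = 0 &
    forall i, (c 0 i != 0) = (i \in finset.setT).
  by apply: (full_support_word genA); rewrite cardsT card_ord.
have i0 : 'I_n := Ordinal (leq_ltn_trans (leq0n k) lt_kn).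
have ci0 : c 0 i0 != 0 by rewrite cE inE.
have freec : row_free c.
  rewrite -kermx_eq0; apply/eqP/row_matrixP => a; rewrite row0.
  set v := row a _; have : v *m c = 0 by rewrite /v -row_mul mulmx_ker row0.
  move=> /rowP/(_ i0)/eqP; rewrite [_ 0 i0]mxE big_ord1 [X in _ == X]mxE.
  rewrite mulf_eq0 (negbTE ci0) orbF.
  by move=> /eqP v0; apply/rowP => b; rewrite [RHS]mxE ord1.
suff /codim_le : (orthogonal_space A c <= X)%VS by rewrite codimX codim_orthogonal_space.
apply/subvP => t /mem_orthogonal_space/(_ 0) tc.
suff : [set` X]%classic t by [].
rewrite XE => L /= LF; apply/(mem_D A) => c' c'A _.
(* The difference vanishes at [i0], so its support has at most [k] elements. *)
have e : c' - (c' 0 i0 / c 0 i0) *: c = 0.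
  apply: (generic_word_eq0 genA (I := [set~ i0]%SET)).
  - by rewrite cardsC1 card_ord nE.
  - by rewrite mulmxBl -scalemxAl cA c'A scaler0 subr0.
  - by move=> i; rewrite !inE negbK => /eqP ->; rewrite !mxE divfK // subrr.
have rc : row 0 c = c by apply/rowP => i; rewrite mxE.
have := pairingB A c' c t (c' 0 i0 / c 0 i0).
rewrite e -[in RHS]rc tc mulr0 subr0 => <-.
by apply: big1 => i _; rewrite mxE mul0r.
Qed.

Lemma athanasiadis_rank_bound : in_intersection_poset A X ->
  #|\bigcup_(S in canonical_presentation A X) S|%SET = n ->
  (athanasiadis_rank A X * (n - k - 1) <= n)%N.
Proof.
move=> /codim2_card_neq nk.
rewrite /athanasiadis_rank; set comps := canonical_presentation A X => cardU.
have compP S : S \in comps -> is_component A X S by rewrite inE => /asboolP.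
have cov i : covers A X i.
  have : i \in (\bigcup_(S in comps) S)%SET.
    suff -> : (\bigcup_(S in comps) S)%SET = finset.setT by rewrite inE.
    by apply/eqP; rewrite eqEcard finset.subsetT cardsT card_ord cardU leqnn.
  move=> /finset.bigcupP[S /compP[ltS XS _] iS].
  exact: component_covers XS ltS iS.
(* A component with more than [k + 1] elements forces [n = k + 2] and is the whole index set. By
   maximality it is then the only component, and the inequality reads [2 <= n]. *)
have [/existsP[S /andP[SP ltS]] | /existsPn small] :=
    boolP [exists S, (S \in comps) && (k.+1 < #|S|)%N].
  have [_ XS _] := compP S SP.
  have nE := large_component genA k_gt0 codimX cov XS ltS.
  have ST : S = finset.setT.
    by apply/eqP; rewrite eqEcard finset.subsetT cardsT card_ord [X in (X <= _)%N]nE.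
  have -> : comps = [set S]%SET.
    apply/finset.setP => S'; rewrite finset.in_set1; apply/idP/eqP => [S'P | -> //].
    have [_ _ max'] := compP S' S'P.
    apply/eqP; apply: contraT; rewrite ST -finset.subTset => /fintype.subsetPn[j _ jS'].
    by case: (max' j jS') => t /XS H L [_ cardL]; apply: H;
      split=> //; rewrite ST finset.subsetT.
  rewrite big_set1 ST cardsT card_ord [X in (X - k - 1)%N]nE -addn2 addKn muln1 nE -addn2.
  by rewrite addKn leq_addl.
have cardS S : S \in comps -> #|S| = k.+1.
  move=> SP; have [ltS _ _] := compP S SP; have := small S.
  by rewrite SP /= -leqNgt => leS; apply/eqP; rewrite eqn_leq leS.
rewrite (eq_bigr (fun=> 1%N)) => [|S /cardS ->]; last by rewrite subSnn.
rewrite sum1_card -sum_nat_const.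
(* Here [n - k - 1] becomes the number of indices missed by [S]; after exchanging the sums, each
   index is counted at most once. *)
rewrite (eq_bigr (fun S : {set 'I_n} => \sum_(i | i \notin S) 1)%N) => [|S /cardS SE]; last first.
  rewrite sum1_card -[RHS](addKn #|S|); have := cardC (mem S).
  by rewrite card_ord SE => ->; rewrite -subnDA addn1.
rewrite (exchange_big_dep xpredT) //= -[X in (_ <= X)%N]card_ord -sum1_card.
apply: leq_sum => i _; rewrite sum1_card; apply/card_le1_eqP => S S' hS hS'.
have /andP[SP iS] : (S \in comps) && (i \notin S) by [].
have /andP[S'P iS'] : (S' \in comps) && (i \notin S') by [].
have [_ XS _] := compP S SP; have [_ XS' _] := compP S' S'P.
by rewrite (small_component_unique genA k_gt0 codimX (cov i) XS XS'
  (cardS S SP) (cardS S' S'P) iS iS').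
Qed.

End Bound.

(** * Arrangements attaining the bound *)

(** With roots four apart, every factor has absolute value at least 2 at the points [4 j - 2] lying
    midway between them. *)
Definition spaced_poly (R : realType) d : {poly R} :=
  \prod_(l < d) ('X - (4 * l%:R)%:P).

Lemma size_spaced_poly (R : realType) d : size (spaced_poly R d) = d.+1.
Proof. by rewrite size_prod_XsubC -sum1_size sum_nat_const card_ord muln1. Qed.

(** The intervals are half-open so that those of different [j] are disjoint. *)
Lemma spaced_poly_root (R : realType) d (e : R) (j : 'I_d) : 0 <= e < 1 ->
  exists x, [/\ (spaced_poly R d).[x] = e,
    4 * j%:R - 2 <= x & x < 4 * j%:R + 2].
Proof.
move=> /andP[e0 e1]; set f := spaced_poly R d.
pose a : R := 4 * j%:R - 2; pose b : R := 4 * j%:R + 2.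
have fE x : f.[x] = \prod_(l < d) (x - 4 * l%:R).
  by rewrite horner_prod; apply: eq_bigr => l _; rewrite !hornerE.
have spaced (l : 'I_d) : l != j ->
    4 * l%:R + 4 <= 4 * j%:R :> R \/ 4 * j%:R + 4 <= 4 * l%:R :> R.
  by rewrite neq_ltn => /orP[]; rewrite -(ler_nat R) -natr1 => lt; [left|right]; lra.
(* f alternates in sign at the points 4j - 2, where |f| >= 1, so every value
   in [0, 1) is taken between two consecutive ones. *)
have far x : x = a \/ x = b -> 1 <= `|f.[x]|.
  move=> xE; rewrite fE normr_prod; apply: (big_ind (fun y : R => 1 <= y)) => //.
    by move=> y z; apply: mulr_ege1.
  move=> l _; rewrite ler_normr; apply/orP.
  by case: (eqVneq l j) => [-> | /spaced[]] => [|lj|lj]; case: xE => ->; rewrite /a /b;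
    (left; lra) || (right; lra).
(* The [j]-th factor is -2 at [a] and 2 at [b]; each other factor has the same sign at both ends. *)
have neg : f.[a] * f.[b] < 0.
  rewrite !fE -big_split (bigD1 j) //= pmulr_llt0.
    rewrite /a /b; nra.
  by apply: prodr_gt0 => l /spaced[]; rewrite /a /b; nra.
have ivt (p : {poly R}) : p.[a] <= 0 <= p.[b] ->
    exists x, [/\ p.[x] = 0, a <= x & x <= b].
  move=> pab; have [|x /andP[ax xb] /rootP px] := poly_ivt _ pab.
    by rewrite /a /b; lra.
  by exists x.
have fb : f.[b] != e.
  by apply: contraTneq (far b (or_intror erefl)) => ->; rewrite ger0_norm // -ltNge.
suff [x [fx ax xb]] : exists x, [/\ f.[x] = e, a <= x & x <= b].
  exists x; split=> //; rewrite lt_neqAle xb andbT.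
  by apply: contra fb => /eqP xb'; rewrite /b -xb' fx.
have far_a := far a (or_introl erefl); have far_b := far b (or_intror erefl).
(* According to the sign at [a], either [f - e] or [e - f] goes from nonpositive to nonnegative. *)
have [fa0 | fa0] := ltP f.[a] 0.
  have fb0 : 0 < f.[b] by nra.
  rewrite gtr0_norm // in far_b.
  have [|x [fx ax xb]] := ivt (f - e%:P).
    by rewrite !hornerE; apply/andP; split; lra.
  by exists x; split=> //; move: fx; rewrite !hornerE; lra.
have fb0 : f.[b] < 0 by nra.
rewrite ger0_norm // in far_a.
have [|x [fx ax xb]] := ivt (e%:P - f).
    by rewrite !hornerE; apply/andP; split; lra.
by exists x; split=> //; move: fx; rewrite !hornerE; lra.
Qed.

(** The values [s / q] lie in [[0, 1)]. A chosen preimage determines [s] by its value and [j] by the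
    interval containing it, whence injectivity. *)
Lemma equal_fibres (R : realType) d q :
  exists p : 'I_q * 'I_d -> R, injective p /\
    forall x, (spaced_poly R d).[p x] = x.1%:R / q%:R.
Proof.
have ex (x : 'I_q * 'I_d) : exists y, [/\ (spaced_poly R d).[y] = x.1%:R / q%:R,
    4 * x.2%:R - 2 <= y & y < 4 * x.2%:R + 2].
  have q_gt0 : 0 < q%:R :> R by rewrite ltr0n (leq_ltn_trans _ (ltn_ord x.1)).
  apply: spaced_poly_root; rewrite divr_ge0 ?ler0n // ltr_pdivrMr // mul1r.
  by rewrite ltr_nat ltn_ord.
have [p pP] := choice ex; exists p; split=> [x x' pxx' | x]; last by have [] := pP x.
have [fx xlo xhi] := pP x; have [fx' xlo' xhi'] := pP x'.
rewrite pxx' in fx xlo xhi.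
have q_neq0 : q%:R != 0 :> R by rewrite pnatr_eq0 -lt0n (leq_ltn_trans _ (ltn_ord x.1)).
have e1 : x.1 = x'.1.
  apply/val_inj/eqP; rewrite -(eqr_nat R) -(inj_eq (mulIf (invr_neq0 q_neq0))).
  by rewrite -fx -fx'.
have e2 : x.2 = x'.2.
  apply/val_inj/eqP; rewrite eqn_leq.
  by apply/andP; split; rewrite -ltnS -(ltr_nat R) -natr1; lra.
by rewrite [x]surjective_pairing e1 e2 -surjective_pairing.
Qed.

(** * Arrangements with a prescribed space of words *)

(** The columns of [A] form a basis of the vectors killed by [G]; the left kernel of [A] contains
    the row space of [G] and has the same dimension [n - k = m]. *)
Lemma dual_matrix (F : fieldType) m n k (G : 'M[F]_(m, n)) :
  row_free G -> (k + m)%N = n ->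
  exists A : 'M[F]_(n, k), forall c : 'rV_n, (c *m A == 0) = (c <= G)%MS.
Proof.
move=> freeG km; pose B := kermx G^T.
have rankB : \rank B = k.
  by rewrite mxrank_ker mxrank_tr (eqP freeG) -km addnK.
pose C := row_base B.
have : exists A : 'M[F]_(n, k), \rank A = k /\ G *m A = 0.
  rewrite -rankB; exists (row_base B)^T; split.
    by rewrite mxrank_tr eq_row_base.
  apply: trmx_inj; rewrite trmx_mul trmxK trmx0.
  by apply/sub_kermxP; rewrite eq_row_base.
move=> [A [rankA GA]]; exists A => c.
have GK : (G <= kermx A)%MS by apply/sub_kermxP.
have KG : (kermx A <= G)%MS.
  rewrite -(mxrank_leqif_sup GK) mxrank_ker rankA (eqP freeG).
  by rewrite -km addKn.
apply/eqP/idP => [/sub_kermxP cK | cG]; first exact: submx_trans cK KG.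
by apply/sub_kermxP; apply: submx_trans cG GK.
Qed.

Lemma poly_eq0_on (R : idomainType) (T : finType) (p : T -> R) (S : {set T})
    (g : {poly R}) :
  injective p -> (size g <= #|S|)%N -> (forall i, i \in S -> g.[p i] = 0) -> g = 0.
Proof.
move=> inj_p leS gS; apply/eqP; apply: contraT => g0.
have rootS : all (root g) [seq p i | i <- enum S].
  by apply/allP => x /mapP[i]; rewrite mem_enum => iS ->; apply/rootP/gS.
have := max_poly_roots g0 rootS.
by rewrite size_map -cardE map_inj_uniq // enum_uniq ltnNge leS => /(_ isT).
Qed.

(** [G] is a Vandermonde matrix, and its row space is a Reed-Solomon code. *)
Lemma evaluation_code (R : realType) n k d (p : 'I_n -> R) :
  injective p -> (k + d.+1)%N = n ->
  exists A : 'M[R]_(n, k), generic A /\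
    forall c : 'rV_n, c *m A = 0 <->
      exists2 g : {poly R}, (size g <= d.+1)%N & forall i, c 0 i = g.[p i].
Proof.
move=> inj_p kd.
pose G : 'M[R]_(d.+1, n) := \matrix_(a, i) p i ^+ a.
have GE (v : 'rV_d.+1) i : (v *m G) 0 i = (rVpoly v).[p i].
  rewrite (horner_coef_wide _ (size_poly _ _)) mxE; apply: eq_bigr => a _.
  by rewrite mxE coef_rVpoly_ord.
have freeG : row_free G.
  rewrite -kermx_eq0; apply/eqP/row_matrixP => a; rewrite row0.
  set v := row a _; have vG : v *m G = 0 by rewrite /v -row_mul mulmx_ker row0.
  apply: (can_inj rVpolyK); rewrite linear0.
  apply: (poly_eq0_on (S := finset.setT) inj_p) => [|i _].
    by rewrite cardsT card_ord -kd (leq_trans (size_poly _ _)) // leq_addl.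
  by rewrite -GE vG mxE.
have [A AP] := dual_matrix freeG kd.
have words (c : 'rV_n) : c *m A = 0 <->
      exists2 g : {poly R}, (size g <= d.+1)%N & forall i, c 0 i = g.[p i].
  split=> [/eqP|[g sg gE]].
    rewrite AP => /submxP[v ->]; exists (rVpoly v); first exact: size_poly.
    exact: GE.
  apply/eqP; rewrite AP; apply/submxP; exists (poly_rV g).
  by apply/rowP => i; rewrite GE poly_rV_K.
exists A; split=> //; apply: word_eq0_generic => I c leI /words[g sg gE] cI.
(* A word supported in [I] vanishes on at least [n - k = d + 1] points, more than the degree of [g]
   allows. *)
have g0 : g = 0.
  apply: (poly_eq0_on (S := (~: I)%SET) inj_p) => [|i].
    by rewrite (leq_trans sg) // cardsCs finset.setCK card_ord; lia.
  by rewrite inE -gE => /cI.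
by apply/rowP => i; rewrite gE g0 horner0 mxE.
Qed.

(** * The pencil spanned by [1] and [f] *)

Section Pencil.
Variables (R : realType) (n k d q : nat).
Hypotheses (k_gt0 : (0 < k)%N) (d_gt1 : (1 < d)%N) (q_gt1 : (1 < q)%N).
Hypotheses (kd : (k + d.+1)%N = n).
Variables (A : 'M[R]_(n, k)) (p : 'I_n -> R) (f : {poly R}).
Variables (b : 'I_n -> 'I_q) (e : 'I_q -> R).
Hypotheses (genA : generic A) (inj_p : injective p) (size_f : size f = d.+1).
Hypothesis words : forall c : 'rV_n, c *m A = 0 <->
  exists2 g : {poly R}, (size g <= d.+1)%N & forall i, c 0 i = g.[p i].
Hypotheses (inj_e : injective e) (fE : forall i, f.[p i] = e (b i)).
Hypothesis card_fibre : forall s : 'I_q, #|[set i | b i == s]| = d.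

Definition pencil_matrix : 'M[R]_(2, n) :=
  \matrix_(a, i) (if a == 0 then 1 else f.[p i]).

Definition pencil_space := orthogonal_space A pencil_matrix.

Definition cofibre (s : 'I_q) : {set 'I_n} := [set i | b i != s]%SET.

(** The evaluation of [f - e s], which vanishes exactly on the fibre over [s]. *)
Definition pencil_word (s : 'I_q) : 'rV[R]_n :=
  row 1 pencil_matrix - e s *: row 0 pencil_matrix.

Let X := pencil_space.

Lemma card_cofibre (s : 'I_q) : #|cofibre s| = k.+1.
Proof.
have -> : cofibre s = (~: [set i | b i == s])%SET.
  by apply/finset.setP => i; rewrite !inE.
by rewrite cardsCs finset.setCK card_ord card_fibre -kd addnS subSn ?leq_addl // addnK.
Qed.

Lemma fibre_point (s : 'I_q) : exists i, b i = s.
Proof.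
have : (0 < #|[set i | b i == s]|)%N by rewrite card_fibre ltnW.
by rewrite card_gt0 => /set0Pn[i]; rewrite inE => /eqP; exists i.
Qed.

Lemma pencil_wordE (s : 'I_q) (i : 'I_n) : pencil_word s 0 i = e (b i) - e s.
Proof. by rewrite !mxE /= mulr1 fE. Qed.

Lemma pencil_word_poly (s : 'I_q) (i : 'I_n) : pencil_word s 0 i = (f - (e s)%:P).[p i].
Proof. by rewrite pencil_wordE !hornerE fE. Qed.

Lemma size_pencil_poly (s : 'I_q) : (size (f - (e s)%:P)%R <= d.+1)%N.
Proof.
rewrite (leq_trans (size_polyD _ _)) // geq_max size_polyN size_f leqnn /=.
by rewrite (leq_trans (size_polyC_leq1 _)).
Qed.

Lemma pencil_word_kernel (s : 'I_q) : pencil_word s *m A = 0.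
Proof.
apply/words; exists (f - (e s)%:P) => [|i];
  by [apply: size_pencil_poly | apply: pencil_word_poly].
Qed.

(** Subtracting the multiple of [f - e s] that agrees with [c] at one point [i0] outside the fibre
    leaves a polynomial of degree at most [d] with [d + 1] zeros. *)
Lemma word_on_cofibre (s : 'I_q) (c : 'rV_n) :
  c *m A = 0 -> supported (cofibre s) c -> exists a, c = a *: pencil_word s.
Proof.
move=> /words[g size_g gE] cS.
have /fintype.card_gt0P[i0] : (0 < #|cofibre s|)%N by rewrite card_cofibre.
rewrite inE => bi0.
have e0 : e (b i0) - e s != 0 by rewrite subr_eq0 (inj_eq inj_e).
pose a := c 0 i0 / (e (b i0) - e s); exists a.
pose h := g - a *: (f - (e s)%:P).
have hE i : h.[p i] = c 0 i - a * (e (b i) - e s).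
  by rewrite /h !hornerE gE fE.
have h0 : h = 0.
  apply: (poly_eq0_on (S := (i0 |: [set i | b i == s])%SET) inj_p).
    rewrite cardsU1 inE bi0 card_fibre add1n.
    rewrite (leq_trans (size_polyD _ _)) // geq_max size_polyN size_g /=.
    by rewrite (leq_trans (size_scale_leq _ _)) // size_pencil_poly.
  move=> i; rewrite !inE hE => /orP[/eqP -> | /eqP bi].
    by rewrite /a divfK // subrr.
  by rewrite bi subrr mulr0 subr0; apply: cS; rewrite inE bi eqxx.
apply/rowP => i; rewrite [RHS]mxE pencil_wordE; apply/eqP.
by rewrite -subr_eq0 -hE h0 horner0.
Qed.

Lemma annihilates_row a : annihilates A X (row a pencil_matrix).
Proof. by move=> t /mem_orthogonal_space. Qed.

Lemma annihilates_pencil_word (s : 'I_q) : annihilates A X (pencil_word s).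
Proof.
by move=> t tX; rewrite pairingB !annihilates_row // mulr0 subr0.
Qed.

Lemma mem_D_cofibre (s : 'I_q) t : D A (cofibre s) t <-> pairing A (pencil_word s) t = 0.
Proof.
split=> [/mem_D H | H].
  apply: H; first exact: pencil_word_kernel.
  by move=> i; rewrite inE negbK => /eqP bi; rewrite pencil_wordE bi subrr.
apply/mem_D => c cA cS; have [a ->] := word_on_cofibre cA cS.
by rewrite pairingZ H mulr0.
Qed.

Let s0 : 'I_q := Ordinal (ltnW q_gt1).
Let s1 : 'I_q := Ordinal q_gt1.

(** A relation gives [v0 + v1 * e s = 0] for all [s], and [e] takes two distinct values. *)
Lemma row_free_pencil : row_free pencil_matrix.
Proof.
rewrite -kermx_eq0; apply/eqP/row_matrixP => a; rewrite row0.
set v := row a _; have vW : v *m pencil_matrix = 0 by rewrite /v -row_mul mulmx_ker row0.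
have vE s : v 0 0 + v 0 1 * e s = 0.
  have [i bi] := fibre_point s.
  have /rowP/(_ i) := vW; rewrite mxE [RHS]mxE => <-.
  rewrite !big_ord_recr big_ord0 /= add0r ![pencil_matrix _ _]mxE /= mulr1 fE bi.
  by congr (v 0 _ + v 0 _ * _); apply: val_inj.
have e01 : e s1 - e s0 != 0 by rewrite subr_eq0 (inj_eq inj_e).
have v1 : v 0 1 = 0.
  apply/eqP; rewrite -[_ == 0]orbF -(negbTE e01) -mulf_eq0 mulrBr; apply/eqP.
  by have := vE s1; have := vE s0; lra.
have v0 : v 0 0 = 0 by have := vE s0; rewrite v1 mul0r addr0.
apply/rowP => i; rewrite [RHS]mxE.
by case: i => [[|[|//]] lt]; [rewrite -[RHS]v0|rewrite -[RHS]v1];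
  congr (v 0 _); apply: val_inj.
Qed.

Lemma codim_pencil : codim X = 2%N.
Proof. exact: (codim_orthogonal_space genA k_gt0 row_free_pencil). Qed.

(** The cofibres index the family: two of the words [f - e s] already span both [1] and [f]. *)
Lemma pencil_in_poset : in_intersection_poset A X.
Proof.
exists [set cofibre s | s : 'I_q]%SET => [L /imsetP[s _ ->]|]; first exact: card_cofibre.
apply/seteqP; split=> t.
  move=> /= tX L /= /imsetP[s _ ->]; apply/mem_D_cofibre.
  exact: annihilates_pencil_word.
move=> H; have P s : pairing A (pencil_word s) t = 0.
  by apply/mem_D_cofibre; apply: H; rewrite /= imset_f.
have e01 : e s1 - e s0 != 0 by rewrite subr_eq0 (inj_eq inj_e).
pose P0 := pairing A (row 0 pencil_matrix) t.
pose P1 := pairing A (row 1 pencil_matrix) t.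
have PE s : P1 - e s * P0 = 0 by rewrite -(P s) pairingB.
have P0E : P0 = 0.
  apply/eqP; rewrite -[_ == 0]orFb -(negbTE e01) -mulf_eq0 mulrBl; apply/eqP.
  by have := PE s1; have := PE s0; lra.
have P1E : P1 = 0 by have := PE s0; rewrite P0E mulr0 subr0.
apply/mem_orthogonal_space => a.
by case: a => [[|[|//]] lt]; [rewrite -[RHS]P0E|rewrite -[RHS]P1E];
  congr (pairing A (row _ _) t); apply: val_inj.
Qed.

Lemma pencil_covers (i : 'I_n) : covers A X i.
Proof.
exists (row 0 pencil_matrix); first exact: annihilates_row.
by rewrite !mxE eqxx oner_eq0.
Qed.

Lemma sub_Dset_cofibre (s : 'I_q) : ([set` X] `<=` Dset A (cofibre s))%classic.
Proof.
apply/(sub_Dset genA); first by rewrite card_cofibre.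
move=> c cA cS t tX; have [a ->] := word_on_cofibre cA cS.
by rewrite pairingZ annihilates_pencil_word // mulr0.
Qed.

(** Since [d > 1] excludes [n = k + 2], components have [k + 1] elements. One that misses [i] must
    be the cofibre of [b i], which also misses [i]; conversely, no cofibre can be enlarged. *)
Lemma pencil_presentation :
  canonical_presentation A X = [set cofibre s | s : 'I_q]%SET.
Proof.
have nk : n <> k.+2 by rewrite -kd; lia.
have small S : ([set` X] `<=` Dset A S)%classic -> (#|S| <= k.+1)%N.
  move=> XS; rewrite leqNgt; apply/negP => ltS; apply: nk.
  exact (large_component genA k_gt0 codim_pencil pencil_covers XS ltS).
apply/finset.setP => S; rewrite inE; apply/asboolP/imsetP => [[ltS XS _] | [s _ ->]].
  have cardS : #|S| = k.+1 by apply/eqP; rewrite eqn_leq small.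
  have [i _ iS] : exists2 i, i \in finset.setT & i \notin S.
    apply/fintype.subsetPn; rewrite finset.subTset.
    by apply/eqP => ST; move: cardS; rewrite ST cardsT card_ord -kd; lia.
  exists (b i) => //.
  have ibi : i \notin cofibre (b i) by rewrite inE eqxx.
  by rewrite (small_component_unique genA k_gt0 codim_pencil (pencil_covers i) XS
    (@sub_Dset_cofibre (b i)) cardS (card_cofibre _) iS ibi).
split; [by rewrite card_cofibre | exact: sub_Dset_cofibre | move=> j js /small].
by rewrite cardsU1 js card_cofibre ltnn.
Qed.

Lemma pencil_presentation_cover :
  (\bigcup_(S in canonical_presentation A X) S)%SET = finset.setT.
Proof.
apply/finset.setP => i; rewrite [RHS]inE pencil_presentation; apply/finset.bigcupP.
have [s si] : exists s, b i != s.
  by case: (eqVneq (b i) s0) => [->|]; [exists s1 | exists s0].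
by exists (cofibre s); rewrite ?imset_f // inE.
Qed.

Lemma pencil_athanasiadis_rank : athanasiadis_rank A X = q.
Proof.
rewrite /athanasiadis_rank pencil_presentation.
rewrite (eq_bigr (fun=> 1%N)) => [|S /imsetP[s _ ->]]; last first.
  by rewrite card_cofibre subSnn.
(* Fibres are nonempty, so distinct values have distinct cofibres. *)
rewrite sum1_card card_imset ?card_ord // => s s' /finset.setP ss'.
have [i bi] := fibre_point s; have := ss' i.
by rewrite !inE bi eqxx => /esym/negbFE/eqP.
Qed.

End Pencil.

Lemma non_very_generic_exists (R : realType) k d q :
  (0 < k)%N -> (1 < d)%N -> (2 < q)%N -> (k + d.+1)%N = (q * d)%N ->
  exists (A : 'M[R]_(q * d, k)) (X : {vspace 'rV[R]_(q * d)}),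
     [/\ generic A, in_intersection_poset A X,
         (\bigcup_(S in canonical_presentation A X) S)%SET = finset.setT,
         codim X = 2%N & athanasiadis_rank A X = q].
Proof.
move=> k_gt0 d_gt1 q_gt2 kd; have q_gt1 := ltnW q_gt2.
have [r [inj_r rE]] := equal_fibres R d q.
have card_n : (q * d)%N = #|{: 'I_q * 'I_d}| by rewrite card_prod !card_ord.
(* The [q * d] indices are identified with pairs of a value and a position in its fibre. *)
pose h (i : 'I_(q * d)) : 'I_q * 'I_d := enum_val (cast_ord card_n i).
have bij_h : bijective h 
  by apply: bij_comp (enum_val_bij _) (Bijective (cast_ordK _) (cast_ordKV _)).
pose p i := r (h i); pose b i := (h i).1.
have inj_p : injective p by move=> i j /inj_r/(bij_inj bij_h).
have [A [genA words]] := evaluation_code inj_p kd.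
pose e (s : 'I_q) : R := s%:R / q%:R.
have inj_e : injective e.
  have q0 : q%:R != 0 :> R by rewrite pnatr_eq0 -lt0n ltnW.
  by move=> s s' /(mulIf (invr_neq0 q0))/eqP; rewrite eqr_nat => /eqP/val_inj.
have card_fibre s : #|[set i | b i == s]| = d.
  have -> : [set i | b i == s]%SET = (h @^-1: (finset.setX [set s] [set: 'I_d]))%SET.
    by apply/finset.setP => i; rewrite !inE andbT.
  rewrite on_card_preimset; last exact: onW_bij.
  by rewrite cardsX cards1 cardsT card_ord mul1n.
have fE i : (spaced_poly R d).[p i] = e (b i) by rewrite rE.
have size_f := size_spaced_poly R d.
exists A, (pencil_space A p (spaced_poly R d)); split=> //.
- exact: (pencil_in_poset q_gt1 kd inj_p size_f words inj_e fE card_fibre).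
- exact: (pencil_presentation_cover k_gt0 d_gt1 q_gt1 kd genA inj_p
    size_f words inj_e fE card_fibre).
- exact: (codim_pencil k_gt0 d_gt1 q_gt1 genA inj_e fE card_fibre).
- exact: (pencil_athanasiadis_rank k_gt0 d_gt1 q_gt1 kd genA inj_p
    size_f words inj_e fE card_fibre).
Qed.

(** Sharpness excludes three cases. At [n = k + 1] the quotient is a division by zero, with value 0;
    at [n = k + 2] rank two gives the single component [[n]] and [a_X = 2 < n]; at [n = 2 (k + 1)]
    the quotient is 2, the rank itself, so [X] would be very generic. *)
Theorem theorem5p1 (R : realType) (n k : nat)
    (k_gt0 : (0 < k)%N) (lt_kn : (k < n)%N) :
  (forall (A : 'M[R]_(n, k)) (X : {vspace 'rV[R]_n}),
     generic A -> in_intersection_poset A X ->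
     #|\bigcup_(S in canonical_presentation A X) S|%SET = n ->
     codim X = 2%N ->
     (athanasiadis_rank A X)%:R <= n%:R / (n - k - 1)%:R :> rat)
  /\
  ((k + 2 < n)%N -> n <> (2 * (k + 1))%N ->
   n%:R / (n - k - 1)%:R \is a @Num.int rat ->
   exists (A : 'M[R]_(n, k)) (X : {vspace 'rV[R]_n}),
     [/\ generic A, in_intersection_poset A X,
         #|\bigcup_(S in canonical_presentation A X) S|%SET = n,
         codim X = 2%N
       & ~ very_generic A X
         /\ (athanasiadis_rank A X)%:R = n%:R / (n - k - 1)%:R :> rat]).
Proof.
split=> [A X genA posetX cardU codimX | lt_k2n neq_n].
  have neq_nk1 := codim2_card_neq genA k_gt0 lt_kn codimX posetX.
  rewrite ler_pdivlMr ?ltr0n; last by lia.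
  rewrite -natrM ler_nat.
  exact: (athanasiadis_rank_bound genA k_gt0 lt_kn codimX posetX cardU).
set d := (n - k - 1)%N.
have d_neq0 : d%:R != 0 :> rat by rewrite pnatr_eq0; lia.
move=> /intrP[z zE].
have nE : n%:Z = (z * d%:Z)%R.
  by apply: (@intr_inj rat); rewrite rmorphM /= -!pmulrn -zE divfK.
have [q zq] : exists q : nat, z = q%:Z.
  by exists `|z|%N; rewrite gez0_abs //; rewrite /d in nE; nia.
have {zE}qE : n%:R / d%:R = q%:R :> rat by rewrite zE zq.
have {nE zq z}nE : n = (q * d)%N by rewrite zq in nE; lia.
(* The values 0 and 1 of [q] contradict [0 < n] and [d < n]; the value 2 means [n = 2 (k + 1)]. *)
have q_gt2 : (2 < q)%N by case: q nE {qE} => [|[|[|q]]]; rewrite /d; lia.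
have kd : (k + d.+1)%N = (q * d)%N by rewrite -nE /d; lia.
have d_gt1 : (1 < d)%N by rewrite /d; lia.
rewrite qE; move: d kd d_gt1 nE {d_neq0 qE} => d kd d_gt1 nE.
move: (non_very_generic_exists R k_gt0 d_gt1 q_gt2 kd); rewrite -nE.
move=> [A [X [genA posetX cover codimX rankX]]]; exists A, X; split=> //.
  by rewrite cover cardsT card_ord.
rewrite /very_generic codimX rankX; split=> // q2.
by rewrite -q2 in q_gt2.
Qed.
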